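(* Let $\mathcal{A}$ be a Banach algebra such that $\mathrm{rad}(\mathcal{A})=\mathrm{rann}(\mathcal{A})$ and $\mathcal{A}/\mathrm{rad}(\mathcal{A})$ is commutative, and suppose $\mathcal{A}$ has a right identity. Then the following are equivalent: (i) $\mathcal{A}$ has an identity; (ii) every derivation of $\mathcal{A}$ is zero; (iii) every inner derivation of $\mathcal{A}$ is zero; (iv) $\mathcal{A}$ is commutative.
   Context: $\mathrm{rad}(\mathcal{A})$ is the Jacobson radical and $\mathrm{rann}(\mathcal{A})=\{c\in\mathcal{A}: ac=0\ \forall a\in\mathcal{A}\}$. A derivation is a linear map $d$ with $d(ab)=d(a)b+ad(b)$. For $a\in\mathcal{A}$ the inner derivation induced by $a$ is $d_a(b)=ba-ab$. *)

(* Defs.v *)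
From HB Require Import structures.
From mathcomp Require Import all_boot all_order all_algebra.
From mathcomp Require Import complex.
From mathcomp Require Import all_classical all_reals all_analysis.
Set Implicit Arguments. Unset Strict Implicit. Unset Printing Implicit Defensive.
Import Order.TTheory GRing.Theory Num.Theory.
Import numFieldNormedType.Exports.
Local Open Scope ring_scope.
Local Open Scope classical_set_scope.

Section BanachAlgebra.
Variables (R : realType) (V : completeNormedModType R[i]) (mul : V -> V -> V).

Definition is_banach_algebra : Prop :=
  [/\ (forall (k : R[i]) (a b c : V), mul (k *: a + b) c = k *: mul a c + mul b c),
      (forall (k : R[i]) (a b c : V), mul c (k *: a + b) = k *: mul c a + mul c b),
      (forall a b c : V, mul (mul a b) c = mul a (mul b c)) &
      (forall a b : V, `|mul a b| <= `|a| * `|b|)].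

Definition quasi_invertible (a : V) : Prop :=
  exists b : V, a + b - mul a b = 0 /\ b + a - mul b a = 0.

Definition jrad : set V := [set a | forall b : V, quasi_invertible (mul b a)].

Definition rann : set V := [set c | forall a : V, mul a c = 0].

Definition is_derivation (d : V -> V) : Prop :=
  (forall (k : R[i]) (x y : V), d (k *: x + y) = k *: d x + d y) /\
  (forall x y : V, d (mul x y) = mul (d x) y + mul x (d y)).

Definition inner_der (a : V) : V -> V := fun b => mul b a - mul a b.

Definition has_identity : Prop := exists e : V, forall a, mul a e = a /\ mul e a = a.
Definition has_right_identity : Prop := exists e : V, forall a, mul a e = a.
Definition is_commutative : Prop := forall a b : V, mul a b = mul b a.

Definition quot_rad_commutative : Prop := forall a b : V, mul a b - mul b a \in jrad.

End BanachAlgebra.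

(* Main.v *)
Require Import Defs.
From HB Require Import structures.
From mathcomp Require Import all_boot all_order all_algebra.
From mathcomp Require Import complex.
From mathcomp Require Import all_classical all_reals all_analysis.
From mathcomp Require Import ring lra.
Set Implicit Arguments. Unset Strict Implicit.
Import Order.TTheory GRing.Theory Num.Theory.
Import numFieldNormedType.Exports.
Local Open Scope ring_scope.
Local Open Scope classical_set_scope.

(** With a right identity at hand, only one implication is deep: if [A] has an
    identity then [rann A = 0], so [A] is commutative, unital and semisimple, and
    every (possibly discontinuous) derivation [d] of such an algebra vanishes
    (Singer-Wermer, Johnson).

    Let [S] be the separating space of [d], an ideal. By the closed graph argument
    [d] is bounded modulo [S], and a gliding hump shows that there is no sequence
    [a_n] with [a_1 ... a_n S] never contained in the closure of
    [a_1 ... a_(n+1) S]. Hence, if [S <> 0], some nonzero multiple [a S] is minimal: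
    each [b a S] is zero or dense in [a S]. Semisimplicity then yields an idempotent
    [e <> 0] in [S] such that [e A] is a field, so [e A = C e] by Gelfand-Mazur. Since
    [d e = 0], [e * d x = d (e * x) = 0] for all [x], whereas [e] is a limit of values
    of [d]: a contradiction. So [S = 0] and [d] is bounded. The Kleinecke-Shirokov
    identity [ad(a)^n (d^n) = n! (d a)^n] now makes [b * d a] quasinilpotent for all
    [b], so that [d a] lies in the radical. *)

(** * Real-valued norms and Banach algebras *)

Section RealNorm.
Variable R : realType.

(** The norm of [V] takes values in [R[i]]; its real part moves the estimates into the ordered field
    [R]. *)
Definition rnorm (V : normedZmodType R[i]) (v : V) : R := complex.Re `|v|.

Lemma rnormE (V : normedZmodType R[i]) (v : V) : (rnorm v)%:C%C = `|v|.
Proof. by rewrite /rnorm RRe_real// normr_real. Qed.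

Lemma rnorm_triangle (V : normedZmodType R[i]) (v w : V) :
  rnorm (v + w) <= rnorm v + rnorm w.
Proof. by rewrite -lecR rmorphD /= !rnormE ler_normD. Qed.

Lemma rnorm_eq0 (V : normedZmodType R[i]) (v : V) : rnorm v = 0 -> v = 0.
Proof. by move=> h; apply/normr0_eq0; rewrite -rnormE h. Qed.

Lemma rnormM (z w : R[i]) : rnorm (z * w) = rnorm z * rnorm w.
Proof. by apply: complexI; rewrite rmorphM /= !rnormE normrM. Qed.

Lemma rnorm_real (t : R) : rnorm t%:C%C = `|t|.
Proof.
apply: complexI; rewrite rnormE normc_def /= expr0n /= addr0.
by rewrite sqrtr_sqr.
Qed.

Lemma rnorm_ge0 (V : normedZmodType R[i]) (v : V) : 0 <= rnorm v.
Proof. by rewrite -lecR rnormE normr_ge0. Qed.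

End RealNorm.

(** * Geometric estimates with ratio one half *)

Section GeometricBounds.
Variable R : realType.

Lemma exp2V_gt0 n : 0 < 2 ^- n :> R.
Proof. by rewrite invr_gt0 exprn_gt0. Qed.

Lemma exp2VS n : 2 ^- n = 2 * 2 ^- n.+1 :> R.
Proof. by rewrite exprS invfM mulrA divff ?mul1r. Qed.

Lemma exp2V_lt (e : R) : 0 < e -> exists n, 2 ^- n < e.
Proof.
move=> e0; exists (Num.truncn e^-1).+1.
rewrite invf_plt ?posrE ?exprn_gt0//.
apply: (lt_le_trans (truncnS_gt _)).
by rewrite -natrX ler_nat ltnW// ltn_expl.
Qed.

Lemma exp2V_mul_lt (c e : R) : 0 < e -> exists n, c * 2 ^- n < e.
Proof.
move=> e0; have c0 : 0 < `|c| + 1 by rewrite ltr_wpDl.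
have [n hn] := exp2V_lt (divr_gt0 e0 c0).
exists n; move: hn; rewrite ltr_pdivlMr// mulrC => /le_lt_trans; apply.
rewrite ler_wpM2r ?(ltW (exp2V_gt0 n))//.
by have := ler_norm c; lra.
Qed.

Lemma le0_exp2V (t c : R) : (forall n, t <= c * 2 ^- n) -> t <= 0.
Proof.
move=> h; rewrite leNgt; apply/negP => t0.
have [n] := exp2V_mul_lt c t0.
by rewrite ltNge h.
Qed.

Lemma exp_lt_half (t : R) : 0 <= t -> t < 1 -> exists n, t ^+ n.+1 <= 2^-1.
Proof.
move=> t0 t1.
have /cvgrPdist_lt/(_ 2^-1 _)[|n _ hn] : (fun n => t ^+ n) @ \oo --> (0 : R).
- by apply: cvg_expr; rewrite ger0_norm.
- by [].
exists n; have := hn n.+1 (leqnSn n).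
by rewrite sub0r normrN ger0_norm ?exprn_ge0// => /ltW.
Qed.

End GeometricBounds.

(** The norm is a plain function on a bare algebra, so that it can be attached to a ring structure
    built afterwards from [mul]. The value [N 1] is not normalized. *)
Record banach_norm (R : realType) (A : comAlgType R[i]) (N : A -> R) : Prop := {
  nm_eq0 : forall x, N x = 0 -> x = 0;
  nmD : forall x y, N (x + y) <= N x + N y;
  nmZ : forall (k : R[i]) x, N (k *: x) = rnorm k * N x;
  nmM : forall x y, N (x * y) <= N x * N y;
  nm_complete : forall u : nat -> A,
    (forall e, 0 < e -> exists n0, forall m n,
       (n0 <= m)%N -> (n0 <= n)%N -> N (u m - u n) < e) ->
    exists l, forall e, 0 < e -> exists n0, forall n,
       (n0 <= n)%N -> N (l - u n) < e }.

(** * Neumann series and Baire category *)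

Section BanachAlgebraTheory.
Variables (R : realType) (A : comAlgType R[i]) (N : A -> R).
Hypothesis bN : banach_norm N.

Lemma nmZr (t : R) x : N (t%:C%C *: x) = `|t| * N x.
Proof. by rewrite (nmZ bN) rnorm_real. Qed.

Lemma nm0 : N 0 = 0.
Proof. by rewrite -(scale0r (0 : A)) -[0 in LHS]/(0%:C%C) nmZr normr0 mul0r. Qed.

Lemma nmN x : N (- x) = N x.
Proof.
rewrite -scaleN1r -(rmorph1 (real_complex R)) -rmorphN nmZr.
by rewrite normrN1 mul1r.
Qed.

Lemma nm_ge0 x : 0 <= N x.
Proof. by have := nmD bN x (- x); rewrite subrr nm0 nmN; lra. Qed.

Lemma nmB x y : N (x - y) <= N x + N y.
Proof. by rewrite -(nmN y) (nmD bN). Qed.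

Lemma nm_distC x y : N (x - y) = N (y - x).
Proof. by rewrite -nmN opprB. Qed.

Lemma nm_split z x y : N (x - y) <= N (x - z) + N (z - y).
Proof. by rewrite -{1}(subrK z x) -addrA (nmD bN). Qed.

Lemma nm_le0 x : N x <= 0 -> x = 0.
Proof. by move=> h; apply: (nm_eq0 bN); apply/eqP; rewrite eq_le h nm_ge0. Qed.

Lemma nmM_le x y s t : N x <= s -> N y <= t -> N (x * y) <= s * t.
Proof.
by move=> xs yt; apply: (le_trans (nmM bN _ _)); rewrite ler_pM ?nm_ge0.
Qed.

Lemma nmX x n : N (x ^+ n.+1) <= N x ^+ n.+1.
Proof.
elim: n => [|n IH]; first by rewrite !expr1.
by rewrite exprS [leRHS]exprS nmM_le.
Qed.

(** Telescoping against a geometric series gives the Cauchy property; the factor 2 is the sum of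
    that series. *)
Lemma geometric_limit (u : nat -> A) c :
  (forall n, N (u n.+1 - u n) <= c * 2 ^- n) ->
  exists l, forall n, N (l - u n) <= 2 * c * 2 ^- n.
Proof.
move=> hu.
have c0 : 0 <= c.
  by have := le_trans (nm_ge0 _) (hu 0%N); rewrite expr0 invr1 mulr1.
have tail n k : N (u (n + k)%N - u n) <= 2 * c * (2 ^- n - 2 ^- (n + k)).
  elim: k => [|k IH]; first by rewrite addn0 !subrr nm0 mulr0.
  have := nm_split (u (n + k)%N) (u (n + k.+1)%N) (u n).
  by have := hu (n + k)%N; move: IH; rewrite addnS (exp2VS R (n + k)); lra.
have tail' n k : N (u (n + k)%N - u n) <= 2 * c * 2 ^- n.
  by have := tail n k; have := exp2V_gt0 R (n + k); nra.
have [|l hl] := @nm_complete _ _ _ bN u.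
  move=> e e0; have [n0 h0] := exp2V_mul_lt (4 * c) e0.
  exists n0 => m n /subnKC <- /subnKC <-.
  have := nm_split (u n0) (u (n0 + (m - n0))%N) (u (n0 + (n - n0))%N).
  have := tail' n0 (m - n0)%N; have := tail' n0 (n - n0)%N.
  rewrite (nm_distC (u n0)); lra.
exists l => n; apply/ler_addgt0Pr => e e0.
have [n0 h0] := hl _ e0.
have := nm_split (u (n + n0)%N) l (u n).
have := h0 _ (leq_addl n n0); have := tail' n n0; lra.
Qed.

Lemma neumann_half w : N w <= 2^-1 -> exists v, (1 - w) * v = 1.
Proof.
move=> w2; pose u n := \sum_(i < n) w ^+ i.
have hw n : N (w ^+ n) <= N 1 * 2 ^- n.
  elim: n => [|n IH]; first by rewrite !expr0 invr1 mulr1.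
  by rewrite exprSr (le_trans (nmM_le IH w2))// exprSr invfM mulrA.
have [l hl] : exists l, forall n, N (l - u n) <= 2 * N 1 * 2 ^- n.
  by apply: geometric_limit => n; rewrite /u big_ord_recr /= addrAC subrr add0r.
exists l; apply/eqP; rewrite -subr_eq0; apply/eqP/nm_le0.
apply: (@le0_exp2V R _ (N (1 - w) * (2 * N 1) + N 1)) => n.
have -> : (1 - w) * l - 1 = (1 - w) * (l - u n) - w ^+ n.
  by have := subrX1 w n; rewrite -/(u n) => /eqP; rewrite subr_eq => /eqP ->; ring.
apply: (le_trans (nmB _ _)).
have := nmM_le (lexx (N (1 - w))) (hl n).
by have := hw n; lra.
Qed.

(** Some power [w ^+ m] has norm at most one half, and [1 - w] divides [1 - w ^+ m]. *)
Lemma neumann_pow w n : N (w ^+ n.+1) < 1 -> exists v, (1 - w) * v = 1.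
Proof.
move=> w1.
have [k hk] := exp_lt_half (nm_ge0 _) w1.
have [v hv] := neumann_half (le_trans (nmX (w ^+ n.+1) k) hk).
move: hv; rewrite -exprM; set m := (n.+1 * k.+1)%N => hv.
exists ((\sum_(i < m) w ^+ i) * v); rewrite mulrA -[RHS]hv; congr (_ * _).
by rewrite -[RHS]opprB subrX1 -mulNr opprB.
Qed.

Lemma neumann w : N w < 1 -> exists v, (1 - w) * v = 1.
Proof. by move=> w1; apply: (@neumann_pow w 0); rewrite expr1. Qed.

Lemma nm_idempotent_ge1 e : e != 0 -> e * e = e -> 1 <= N e.
Proof.
move=> e0 ee; have N0 : 0 < N e.
  by rewrite lt_def nm_ge0 andbT; apply: contra_neq e0; exact: (nm_eq0 bN).
by have := nmM bN e e; rewrite ee -{1}(mulr1 (N e)) ler_pM2l.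
Qed.

(** Baire category: if no [E n] were dense in a ball, nested balls avoiding each [E n] in turn would
    shrink to a point outside all of them. *)
Lemma baire_cover (E : nat -> A -> Prop) : (forall x, exists n, E n x) ->
  exists n x0 r, 0 < r /\ forall x, N (x - x0) < r ->
    forall e, 0 < e -> exists y, E n y /\ N (y - x) < e.
Proof.
move=> cover; apply: contrapT => noball.
(* Points of [E n] stay two new radii away from the new centre, so the limit, within one radius of
   it, misses [E n]. *)
have step (nxr : nat * (A * R)) : exists x'r' : A * R, 0 < nxr.2.2 ->
    [/\ 0 < x'r'.2, N (x'r'.1 - nxr.2.1) + 2 * x'r'.2 <= nxr.2.2 &
        forall y, E nxr.1 y -> 2 * x'r'.2 <= N (y - x'r'.1)].
  case: nxr => n [x0 r] /=; case: (pselect (0 < r)) => r0; last by exists (x0, r).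
  apply: contrapT => nex; apply: noball; exists n, x0, r; split=> // x xr e e0.
  apply: contrapT => far; apply: nex.
  exists (x, Num.min e (r - N (x - x0)) / 2) => _ /=.
  have m0 : 0 < Num.min e (r - N (x - x0)) by rewrite lt_min e0 subr_gt0.
  rewrite [2 * _]mulrC divfK//; split; first by rewrite divr_gt0.
    by rewrite -lerBrDl ge_min lexx orbT.
  move=> y Ey; rewrite ge_min; apply/orP; left; rewrite leNgt; apply/negP => yx.
  by apply: far; exists y.
have {step}[f hf] := choice step.
pose s := fix s n := if n is n.+1 then f (n, s n) else (0, 1).
have s0 n : 0 < (s n).2.
  by elim: n => [|n IH] //=; case: (hf (n, s n) IH).
have sS n : N ((s n.+1).1 - (s n).1) + 2 * (s n.+1).2 <= (s n).2.
  by case: (hf (n, s n) (s0 n)).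
have sE n y : E n y -> 2 * (s n.+1).2 <= N (y - (s n.+1).1).
  by case: (hf (n, s n) (s0 n)) => _ _; apply.
have sle n : (s n).2 <= 2 ^- n.
  elim: n => [|n IH]; first by rewrite expr0 invr1.
  by have := nm_ge0 ((s n.+1).1 - (s n).1); have := sS n; have := exp2VS R n; lra.
have [l hl] : exists l, forall n, N (l - (s n).1) <= 2 * 1 * 2 ^- n.
  apply: geometric_limit => n.
  by have := sS n; have := sle n; have := s0 n.+1; lra.
have tail n k : N ((s (n + k)%N).1 - (s n).1) <= (s n).2 - (s (n + k)%N).2.
  elim: k => [|k IH]; first by rewrite addn0 !subrr nm0.
  have := nm_split (s (n + k)%N).1 (s (n + k.+1)%N).1 (s n).1.
  by have := sS (n + k)%N; have := s0 (n + k).+1; rewrite addnS; lra.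
have lim n : N (l - (s n).1) <= (s n).2.
  rewrite -subr_le0; apply: (@le0_exp2V R _ 2) => k.
  have := nm_split (s (n + k)%N).1 l (s n).1; have := tail n k; have := s0 (n + k)%N.
  have := hl (n + k)%N.
  have : 2 ^- (n + k) <= 2 ^- k :> R.
    by rewrite lef_pV2 ?posrE ?exprn_gt0// ler_weXn2l ?leq_addl// ler1n.
  lra.
have [n En] := cover l.
by have := sE n l En; have := lim n.+1; have := s0 n.+1; lra.
Qed.

End BanachAlgebraTheory.

(** * Gelfand-Mazur *)

Section ComplexPlane.
Variable R : realType.
Implicit Types z w : R[i].

Lemma rnorm_sqr z : rnorm z ^+ 2 = complex.Re z ^+ 2 + complex.Im z ^+ 2.
Proof. by rewrite /rnorm normc_def /= sqr_sqrtr// addr_ge0 ?sqr_ge0. Qed.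

Lemma rnorm_ge_Re z : `|complex.Re z| <= rnorm z.
Proof.
rewrite -(ler_pXn2r (n := 2)) ?nnegrE ?normr_ge0 ?rnorm_ge0// rnorm_sqr.
by rewrite real_normK ?num_real// lerDl sqr_ge0.
Qed.

Lemma rnorm_ge_Im z : `|complex.Im z| <= rnorm z.
Proof.
rewrite -(ler_pXn2r (n := 2)) ?nnegrE ?normr_ge0 ?rnorm_ge0// rnorm_sqr.
by rewrite real_normK ?num_real// lerDr sqr_ge0.
Qed.

Lemma rnorm_le_ReIm z : rnorm z <= `|complex.Re z| + `|complex.Im z|.
Proof.
rewrite -(ler_pXn2r (n := 2)) ?nnegrE ?addr_ge0 ?rnorm_ge0// rnorm_sqr.
rewrite -(real_normK (num_real (complex.Re z))) -(real_normK (num_real (complex.Im z))).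
have := mulr_ge0 (normr_ge0 (complex.Re z)) (normr_ge0 (complex.Im z)); nra.
Qed.

(** Local bounds become uniform by compactness of a square containing the disc. *)
Lemma locally_bounded_on_discs (f : R[i] -> R) :
  (forall z0, exists2 h, 0 < h & exists B, forall z, rnorm (z - z0) < h -> f z <= B) ->
  forall c, exists B, forall z, rnorm z <= c -> f z <= B.
Proof.
move=> locf c.
have cpt := compact_setX (@segment_compact R (- c) c) (@segment_compact R (- c) c).
have := (compact_near_coveringP _).1 cpt R (pinfty_nbhs R)
  (fun B p => f (p.1 +i* p.2)%C <= B) _.
case=> [[a b] _|M [_ hM]].
  have [h h0 [B hB]] := locf (a +i* b)%C.
  have h2 : 0 < h / 2 by lra.
  exists ([set p : R * R | `|p.1 - a| < h / 2 /\ `|p.2 - b| < h / 2],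
          [set t | B < t]) => /=.
    split; last by exists B; split; rewrite ?num_real.
    exists (ball a (h / 2), ball b (h / 2)); first by split; exact: nbhsx_ballx.
    by move=> [u v] [/= + +]; rewrite /ball /= (distrC a) (distrC b).
  move=> [[u v] t] [[/= ua vb] Bt].
  apply: le_trans (ltW Bt); apply: hB.
  by apply: le_lt_trans (rnorm_le_ReIm _) _; rewrite /=; lra.
exists (M + 1) => z zc; have Mz : M < M + 1 by lra.
have /(_ (complex.Re z, complex.Im z)) := hM _ Mz.
have := rnorm_ge_Re z; have := rnorm_ge_Im z.
case: z zc => a b /= zc bc ac; apply.
by split=> /=; rewrite in_itv /= -ler_norml (le_trans _ zc).
Qed.

(** For a root [s] of [w], the squared moduli of [s - 1] and [s + 1] have sum 4 and product
    [rnorm (w - 1) ^+ 2]. One of them is at least 2, which decides between [s] and [- s]. *)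
Lemma sqrt_near1 w : rnorm w = 1 ->
  exists z, [/\ z ^+ 2 = w, rnorm z = 1 & rnorm (z - 1) ^+ 2 <= rnorm (w - 1) ^+ 2 / 2].
Proof.
move=> w1; have [s sw] : exists s, s ^+ 2 = w by exists (sqrtc w); rewrite sqr_sqrtc.
have s1 : rnorm s = 1.
  apply/eqP; rewrite -(eqrXn2 (n := 2)) ?rnorm_ge0 ?ler01//.
  by rewrite expr1n expr2 -rnormM -expr2 sw w1.
have prd : rnorm (w - 1) ^+ 2 = rnorm (s - 1) ^+ 2 * rnorm (s + 1) ^+ 2.
  by rewrite -exprMn -rnormM -sw; congr (rnorm _ ^+ 2); ring.
have sum : rnorm (s - 1) ^+ 2 + rnorm (s + 1) ^+ 2 = 4.
  have : rnorm s ^+ 2 = 1 by rewrite s1 expr1n.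
  by rewrite !rnorm_sqr; case: (s) => a b /=; rewrite oppr0 !addr0; lra.
have [x0 y0] := (sqr_ge0 (rnorm (s - 1)), sqr_ge0 (rnorm (s + 1))).
have [y2|y2] := leP 2 (rnorm (s + 1) ^+ 2).
  by exists s; split => //; rewrite prd; nra.
exists (- s); split; rewrite ?sqrrN//.
  rewrite -mulN1r rnormM s1 mulr1 -(rmorph1 (real_complex R)) -rmorphN.
  by rewrite rnorm_real normrN1.
have -> : rnorm (- s - 1) ^+ 2 = rnorm (s + 1) ^+ 2.
  by rewrite !rnorm_sqr; case: (s) => a b /=; rewrite oppr0 !addr0; ring.
by rewrite prd; nra.
Qed.

(** Square roots near 1 are taken repeatedly from [-1]; the squared distance to 1 starts at 4 and at
    least halves each time. *)
Lemma dyadic_roots_of_minus_one : exists zeta : nat -> R[i], forall m,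
  [/\ zeta m ^+ (2 ^ m) = -1, rnorm (zeta m) = 1 & rnorm (zeta m - 1) ^+ 2 <= 4 * 2 ^- m].
Proof.
have step w : exists z, rnorm w = 1 ->
    [/\ z ^+ 2 = w, rnorm z = 1 & rnorm (z - 1) ^+ 2 <= rnorm (w - 1) ^+ 2 / 2].
  have [/sqrt_near1[z hz]|//] := pselect (rnorm w = 1); first by exists z.
  by exists 0.
have {step}[f hf] := choice step.
exists (fun m => iter m f (-1)); elim=> [|m [IH1 IH2 IH3]] /=.
  rewrite expn0 expr1; split=> //.
    by rewrite -(rmorph1 (real_complex R)) -rmorphN rnorm_real normrN1.
  by rewrite rnorm_sqr /= expr0 invr1 oppr0; lra.
have [f1 f2 f3] := hf _ IH2; split=> //; first by rewrite expnS exprM f1.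
by apply: (le_trans f3); rewrite (exp2VS R m) in IH3; lra.
Qed.

End ComplexPlane.

(** * Resolvents averaged over dyadic roots *)

Section GelfandMazur.
Variables (R : realType) (A : comAlgType R[i]) (N : A -> R).
Hypothesis bN : banach_norm N.
Implicit Types l m : R[i].

Lemma nm_alg l x : N (l%:A * x) = rnorm l * N x.
Proof. by rewrite mulr_algl (nmZ bN). Qed.

Section DyadicMeans.
Variables (e x : A) (r : R[i] -> A).
Hypotheses (e0 : e != 0) (ee : e * e = e).
Hypotheses (rE : forall l, (l%:A - x) * r l = e) (er : forall l, e * r l = r l).

(** The first resolvent identity, in the corner [e A] whose unit is [e]. *)
Lemma resolvent_identity l m : r l - r m = (m - l)%:A * (r l * r m).
Proof.
have -> : r l - r m = (m%:A - x) * r m * r l - (l%:A - x) * r l * r m.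
  by rewrite !rE !er.
by rewrite scalerBl; move: (l%:A) (m%:A) => u v; ring.
Qed.

(** The radius [h] makes [h * N (r m)] at most 1/2, so near [m] the resolvent identity bounds
    [N (r l)] by [2 * N (r m)]; compactness does the rest. *)
Lemma resolvent_bounded c : exists B, forall l, rnorm l <= c -> N (r l) <= B.
Proof.
apply: locally_bounded_on_discs => m; pose h := (2 * (N (r m) + 1))^-1.
have M0 := nm_ge0 bN (r m).
have h0 : 0 < h by rewrite invr_gt0; lra.
exists h => //; exists (2 * N (r m)) => l lm.
have hM : h * N (r m) <= 2^-1.
  by rewrite /h ler_pdivrMl; lra.
have := nm_split bN (r m) (r l) 0; rewrite !subr0 resolvent_identity nm_alg.
have -> : rnorm (m - l) = rnorm (l - m) by rewrite /rnorm distrC.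
have := nmM bN (r l) (r m); have := nm_ge0 bN (r l).
have := nm_ge0 bN (r l * r m).
move: (N (r l * r m)) (N (r l)) => P L P0 L0 PL.
have : rnorm (l - m) * P <= h * (L * N (r m)).
  by rewrite ler_pM ?rnorm_ge0// ltW.
have : h * N (r m) * L <= 2^-1 * L by rewrite ler_wpM2r.
by lra.
Qed.

Variable zeta : nat -> R[i].
Hypothesis zeta_pow : forall n, zeta n ^+ (2 ^ n) = -1.
Hypothesis zeta_norm : forall n, rnorm (zeta n) = 1.

(* The mean of [w * r w] over all [w] with [w ^+ (2 ^ n) = l ^+ (2 ^ n)]. *)
Fixpoint dyadic_mean n l : A :=
  if n is n.+1 then 2^-1%:A * (dyadic_mean n l + dyadic_mean n (zeta n * l))
  else l%:A * r l.

Lemma half_alg : 2^-1%:A + 2^-1%:A = 1 :> A.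
Proof.
have h : 2^-1 + 2^-1 = 1 :> R[i] by have := splitr (1 : R[i]); rewrite !mul1r.
by rewrite -scalerDl h scale1r.
Qed.

Lemma dyadic_mean_e n l : e * dyadic_mean n l = dyadic_mean n l.
Proof.
elim: n l => [|n IH] l /=; first by rewrite mulrCA er.
by rewrite mulrCA mulrDr !IH.
Qed.

Lemma zeta_alg_pow n l : (zeta n * l)%:A ^+ (2 ^ n) = - l%:A ^+ (2 ^ n) :> A.
Proof. by rewrite -!in_algE -!rmorphXn exprMn zeta_pow mulN1r rmorphN. Qed.

(** Partial fractions: with [u] and [X] the [2 ^ n]-th powers of [l] and [x], the mean is
    [u / (u - X)] in [e A]. The induction factors [u ^+ 2 - X ^+ 2], since [zeta n] turns [u] into
    [- u]. *)
Lemma dyadic_meanE n l :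
  (l%:A ^+ (2 ^ n) - x ^+ (2 ^ n)) * dyadic_mean n l = l%:A ^+ (2 ^ n) * e.
Proof.
elim: n l => [|n IH] l; first by rewrite expn0 !expr1 /= mulrCA rE.
have := IH (zeta n * l); have := IH l; rewrite zeta_alg_pow expnSr !exprM /=.
move: (2^-1%:A) half_alg (l%:A ^+ _) (x ^+ _) => h hh u X.
move: (dyadic_mean n l) (dyadic_mean n (zeta n * l)) => p q up uq.
have -> : (u ^+ 2 - X ^+ 2) * (h * (p + q)) =
  h * ((u + X) * ((u - X) * p) - (u - X) * ((- u - X) * q)) by ring.
have -> : u ^+ 2 * e = (h + h) * (u ^+ 2 * e) by rewrite hh mul1r.
by rewrite up uq; ring.
Qed.

(** In [e A], the product of [u / (u - X)] and [- u / (- u - X)] is [u ^+ 2 / (u ^+ 2 - X ^+ 2)]. As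
    [l] is invertible, [u ^+ 2] can be cancelled. *)
Lemma dyadic_mean_mul n l : l != 0 ->
  dyadic_mean n l * dyadic_mean n (zeta n * l) = dyadic_mean n.+1 l.
Proof.
move=> l0; have := dyadic_meanE n.+1 l; have := dyadic_mean_e n.+1 l.
have := dyadic_mean_e n l.
have := dyadic_meanE n (zeta n * l); have := dyadic_meanE n l.
rewrite zeta_alg_pow expnSr !exprM.
have : (l^-1)%:A ^+ (2 ^ n) * l%:A ^+ (2 ^ n) = 1 :> A.
  by rewrite -exprMn -!in_algE -rmorphM mulVf// rmorph1 expr1n.
move: ((l^-1)%:A ^+ _) (l%:A ^+ _) (x ^+ _) => u' u X u'u.
move: (dyadic_mean n.+1 l) (dyadic_mean n l) (dyadic_mean n (zeta n * l)).
move=> P p q hp hq ep eP hP.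
apply/eqP; rewrite -subr_eq0; apply/eqP.
have -> : p * q - P = (u' * u) ^+ 2 * (e * p * q - e * P) by rewrite u'u ep eP; ring.
have -> : (u' * u) ^+ 2 * (e * p * q - e * P) =
  u' ^+ 2 * ((u ^+ 2 * e) * (p * q - P)) by ring.
rewrite -hP.
have -> : (u ^+ 2 - X ^+ 2) * P * (p * q - P) =
  P * (- ((u - X) * p) * ((- u - X) * q) - (u ^+ 2 - X ^+ 2) * P) by ring.
rewrite hp hq hP.
have -> : - (u * e) * (- u * e) = u ^+ 2 * (e * e) by ring.
by rewrite ee subrr !mulr0.
Qed.

Lemma rnorm_half : rnorm (2^-1 : R[i]) = 2^-1.
Proof.
have -> : 2^-1 = (2^-1)%:C%C :> R[i] by rewrite fmorphV rmorph_nat.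
by rewrite rnorm_real gtr0_norm ?invr_gt0.
Qed.

(** The case [n = 0] follows from the resolvent identity; averaging and rotating by [zeta n], of
    modulus 1, keep the constant [L]. *)
Lemma dyadic_mean_lipschitz c : exists2 L, 0 <= L & forall n l m,
  rnorm l <= c -> rnorm m <= c ->
  N (dyadic_mean n l - dyadic_mean n m) <= L * rnorm (l - m).
Proof.
have [B hB] := resolvent_bounded c.
exists (`|B| + `|c| * (`|B| * `|B|)); first by rewrite addr_ge0 ?mulr_ge0.
have {}hB l : rnorm l <= c -> N (r l) <= `|B|.
  by move=> lc; apply: le_trans (hB _ lc) (ler_norm B).
elim=> [|n IH] l m lc mc /=.
  have -> : l%:A * r l - m%:A * r m = (l - m)%:A * r l + m%:A * (r l - r m).
    by rewrite scalerBl; move: (l%:A) (m%:A) => u v; ring.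
  rewrite resolvent_identity; apply: (le_trans (nmD bN _ _)); rewrite !nm_alg.
  have -> : rnorm (m - l) = rnorm (l - m) by rewrite /rnorm distrC.
  have h1 : rnorm (l - m) * N (r l) <= rnorm (l - m) * `|B|.
    by rewrite ler_wpM2l ?rnorm_ge0 ?hB.
  have h2 : N (r l * r m) <= `|B| * `|B| by rewrite (nmM_le bN) ?hB.
  have h3 : rnorm m <= `|c| by rewrite (le_trans mc) ?ler_norm.
  have h4 : rnorm (l - m) * N (r l * r m) <= rnorm (l - m) * (`|B| * `|B|).
    by rewrite ler_wpM2l ?rnorm_ge0.
  have h5 : rnorm m * (rnorm (l - m) * N (r l * r m)) <=
            `|c| * (rnorm (l - m) * (`|B| * `|B|)).
    by rewrite ler_pM ?rnorm_ge0// mulr_ge0 ?rnorm_ge0 ?(nm_ge0 bN).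
  by lra.
rewrite -mulrBr nm_alg rnorm_half opprD addrACA.
have zc k : rnorm k <= c -> rnorm (zeta n * k) <= c by rewrite rnormM zeta_norm mul1r.
have := IH _ _ lc mc; have := IH _ _ (zc _ lc) (zc _ mc).
rewrite -mulrBr rnormM zeta_norm mul1r.
have := nmD bN (dyadic_mean n l - dyadic_mean n m)
  (dyadic_mean n (zeta n * l) - dyadic_mean n (zeta n * m)).
by lra.
Qed.

(** Two nearby elements [p] and [q] with [p * q = (p + q) / 2] are almost idempotent, so the norm of
    [p] cannot lie strictly between 1/4 and 3/8. *)
Lemma dyadic_mean_gap n l : l != 0 ->
  N (dyadic_mean n (zeta n * l) - dyadic_mean n l) <= 8^-1 ->
  N (dyadic_mean n l) <= 3 / 8 -> N (dyadic_mean n l) <= 4^-1.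
Proof.
move=> l0; have := dyadic_mean_mul n l0; rewrite /=.
move: (dyadic_mean n l) (dyadic_mean n (zeta n * l)) => p q pq dpq p38.
have hd : N (2^-1%:A * (q - p)) <= 16^-1 by rewrite nm_alg rnorm_half; lra.
have pE : p = p * p + p * (q - p) - 2^-1%:A * (q - p).
  have -> : p * p + p * (q - p) = p * q by ring.
  rewrite pq; move: (2^-1%:A) half_alg => h hh.
  by rewrite -[LHS]mul1r -hh; ring.
have := nmB bN (p * p + p * (q - p)) (2^-1%:A * (q - p)); rewrite -pE.
have := nmD bN (p * p) (p * (q - p)).
have := nmM_le bN p38 (lexx (N p)); have := nmM_le bN (lexx (N p)) dpq.
by lra.
Qed.

(** With [w = x / (N x + 1)], of norm at most 1, the equation [e = p - w ^+ (2 ^ n) * p] gives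
    [1 <= N e <= 2 * N p]. *)
Lemma dyadic_mean_large n : 2^-1 <= N (dyadic_mean n (N x + 1)%:C%C).
Proof.
set c := N x + 1; have c0 : 0 < c by rewrite /c; have := nm_ge0 bN x; lra.
have cC : c%:C%C != 0 :> R[i] by rewrite (inj_eq (@complexI R)) gt_eqF.
have := dyadic_meanE n c%:C%C; move: (dyadic_mean n _) => p hp.
pose w := (c%:C%C^-1)%:A * x.
have w1 : N w <= 1.
  rewrite nm_alg -fmorphV rnorm_real gtr0_norm ?invr_gt0//.
  by rewrite ler_pdivrMl// /c; lra.
have : 1 <= N e by apply: nm_idempotent_ge1.
have -> : e = p - w ^+ (2 ^ n) * p.
  have u'u : (c%:C%C^-1)%:A ^+ (2 ^ n) * (c%:C%C)%:A ^+ (2 ^ n) = 1 :> A.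
    by rewrite -exprMn -!in_algE -rmorphM mulVf// rmorph1 expr1n.
  rewrite -[LHS]mul1r -u'u -mulrA -hp /w exprMn.
  move: u'u; move: ((c%:C%C^-1)%:A ^+ _) ((c%:C%C)%:A ^+ _) (x ^+ _) => u' u X u'u.
  by rewrite mulrBl mulrBr !mulrA u'u mul1r.
have wn : N (w ^+ (2 ^ n)) <= 1.
  case: (2 ^ n)%N (expn_gt0 2 n) => // k _.
  by apply: (le_trans (nmX bN _ _)); rewrite exprn_ile1 ?(nm_ge0 bN).
have := nmM_le bN wn (lexx (N p)); have := nmB bN p (w ^+ (2 ^ n) * p).
by lra.
Qed.

End DyadicMeans.

(* The means [dyadic_mean n] are Lipschitz uniformly in [n] and, for large [n],
   almost idempotent: along the real segment from [0] to [N x + 1] their norm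
   could not jump from [0] to [1/2]. *)
Lemma gelfand_mazur (e : A) : e != 0 -> e * e = e ->
  (forall b, b * e != 0 -> exists y, b * e * y = e) ->
  forall x, exists l, e * x = l *: e.
Proof.
move=> e0 ee inv x; apply: contrapT => nl.
have res l : exists y, (l%:A - x) * e * y = e.
  apply: inv; apply/eqP; rewrite mulrBl mulr_algl => /eqP; rewrite subr_eq0 => /eqP h.
  by apply: nl; exists l; rewrite h mulrC.
have [r0 hr0] := choice res.
pose r l := e * r0 l.
have rE l : (l%:A - x) * r l = e by rewrite /r mulrA.
have er l : e * r l = r l by rewrite /r mulrA ee.
have [zeta hz] := dyadic_roots_of_minus_one R.
have z1 n : zeta n ^+ (2 ^ n) = -1 by case: (hz n).
have z2 n : rnorm (zeta n) = 1 by case: (hz n).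
pose g := dyadic_mean r zeta.
pose c := N x + 1; have c0 : 0 < c by rewrite /c; have := nm_ge0 bN x; lra.
have [L L0 hL] := dyadic_mean_lipschitz rE er z2 c.
have L0' : 0 <= 8 * L * c by rewrite !mulr_ge0// ltW.
(* The distance from [zeta n] to 1 is controlled through its square. This [n] makes the rotation by
   [zeta n] change the mean by at most 1/8. *)
have [n hn] := exp2V_mul_lt ((8 * L * c) ^+ 2 * 4) (ltr01 : 0 < 1 :> R).
have zn : 8 * L * c * rnorm (zeta n - 1) <= 1.
  have z0 := mulr_ge0 L0' (rnorm_ge0 (zeta n - 1)).
  rewrite -(ler_pXn2r (n := 2)) ?nnegrE// expr1n exprMn.
  case: (hz n) => _ _ h; apply: le_trans (ltW hn).
  by rewrite -[leRHS]mulrA ler_wpM2l ?sqr_ge0.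
(* Each of the [K] steps changes the mean by at most 1/8: from 1/4 its norm reaches at most 3/8, and
   the gap brings it back to 1/4. *)
pose K := (Num.truncn (8 * L * c)).+1.
have K0 : 0 < K%:R :> R by rewrite ltr0n.
have LK : 8 * L * c <= K%:R by rewrite ltW// truncnS_gt.
pose t k : R := c * k%:R / K%:R.
have tc k : (k <= K)%N -> rnorm (t k)%:C%C <= c.
  move=> kK; have t0 : 0 <= t k by rewrite !mulr_ge0 ?invr_ge0// ltW.
  rewrite rnorm_real ger0_norm// /t -mulrA ger_pMr//.
  by rewrite ler_pdivrMr// mul1r ler_nat.
have g0 j : g j 0 = 0.
  elim: j => [|j IH]; first by rewrite /g /= scale0r mul0r.
  by rewrite /g /= mulr0 -/g IH addr0 mulr0.
have small k : (k <= K)%N -> N (g n (t k)%:C%C) <= 4^-1.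
  elim: k => [|k IH] kK.
    by rewrite /t mulr0 mul0r rmorph0 g0 (nm0 bN).
  have gk := IH (ltnW kK).
  apply: (dyadic_mean_gap ee rE er z1).
  - rewrite (inj_eq (@complexI R)) gt_eqF// /t divr_gt0// mulr_gt0// ltr0n.
  - apply: le_trans (hL _ _ _ _ (tc _ kK)) _; first by rewrite rnormM z2 mul1r tc.
    have -> : zeta n * (t k.+1)%:C%C - (t k.+1)%:C%C =
      (zeta n - 1) * (t k.+1)%:C%C by ring.
    rewrite rnormM.
    have := ler_wpM2l (mulr_ge0 L0 (rnorm_ge0 (zeta n - 1))) (tc _ kK).
    by move: zn; lra.
  - have := nm_split bN (g n (t k)%:C%C) (g n (t k.+1)%:C%C) 0; rewrite !subr0.
    have := hL n _ _ (tc _ kK) (tc _ (ltnW kK)).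
    have -> : (t k.+1)%:C%C - (t k)%:C%C = (c / K%:R)%:C%C :> R[i].
      by rewrite -rmorphB /t -mulrBl -mulrBr -natrB// subSnn mulr1.
    rewrite rnorm_real ger0_norm ?divr_ge0 ?(ltW c0)//.
    have : L * (c / K%:R) <= 8^-1 by rewrite mulrA ler_pdivrMr//; lra.
    by rewrite -/g; lra.
have := small K (leqnn K); have := dyadic_mean_large e0 ee rE z1 n.
by rewrite /g /t mulfK ?gt_eqF// -/c; lra.
Qed.

End GelfandMazur.

(** * The separating space of a derivation *)

(** The limits of [d x_n] along sequences [x_n] tending to 0; it is trivial exactly when the graph
    of [d] is closed. *)
Definition separating_space (R : realType) (A : comAlgType R[i]) (N : A -> R)
    (d : A -> A) : set A :=
  [set y | forall e, 0 < e -> exists x, N x < e /\ N (d x - y) < e].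

Section SeparatingSpace.
Variables (R : realType) (A : comAlgType R[i]) (N : A -> R).
Hypothesis bN : banach_norm N.
Variable d : {linear A -> A}.
Hypothesis dM : forall x y, d (x * y) = d x * y + x * d y.
Local Notation S := (separating_space N d).

Lemma sep0 : S 0.
Proof. by move=> e e0; exists 0; rewrite linear0 subrr (nm0 bN). Qed.

Lemma sepD y z : S y -> S z -> S (y + z).
Proof.
move=> Sy Sz e e0; have e2 : 0 < e / 2 by rewrite divr_gt0.
have [x [x1 x2]] := Sy _ e2; have [w [w1 w2]] := Sz _ e2.
exists (x + w); rewrite linearD opprD addrACA.
by have := nmD bN x w; have := nmD bN (d x - y) (d w - z); split; lra.
Qed.

(** The extra term [d a * x] of the product rule tends to 0 with [x]. *)
Lemma sepM a y : S y -> S (a * y).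
Proof.
move=> Sy e e0; pose K := N a + N (d a) + 1.
have [a0 da0] := (nm_ge0 bN a, nm_ge0 bN (d a)).
have K0 : 0 < K by rewrite /K; lra.
have [h h0 eh] : exists2 h, 0 < h & e = K * h.
  by exists (e / K); [rewrite divr_gt0|rewrite mulrC divfK// gt_eqF].
have {e0}[x [x1 x2]] := Sy _ h0; rewrite eh => {e eh}.
exists (a * x); split.
  have := nmM_le bN (lexx (N a)) (ltW x1); have := mulr_ge0 da0 (ltW h0).
  by rewrite /K; lra.
have -> : d (a * x) - a * y = d a * x + a * (d x - y) by rewrite dM; ring.
have := nmD bN (d a * x) (a * (d x - y)).
have := nmM_le bN (lexx (N a)) (ltW x2).
have := nmM_le bN (lexx (N (d a))) (ltW x1).
by rewrite /K; lra.
Qed.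

Lemma sepZr (t : R) y : S y -> S (t%:C%C *: y).
Proof. by move=> Sy; rewrite -mulr_algl; apply: sepM. Qed.

Lemma sepN y : S y -> S (- y).
Proof. by move=> Sy; rewrite -mulN1r; apply: sepM. Qed.

(* The closed graph theorem for the induced map into the quotient by the
   separating space, phrased without quotients. *)
Lemma bounded_mod_sep : exists2 C, 0 <= C &
  forall x, exists2 s, S s & N (d x - s) <= C * N x.
Proof.
pose E (n : nat) x := exists2 s, S s & N (d x - s) <= n%:R.
have [|n [x0 [r [r0 dense]]]] := baire_cover bN (E := E).
  move=> x; exists (Num.truncn (N (d x))).+1, 0; first exact: sep0.
  by rewrite subr0 ltW// truncnS_gt.
(* Differences of two points of the ball carry the density from [x0] to the origin, at the price of
   doubling the bound. *)
have near0 x e : N x < r -> 0 < e ->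
    exists y s, [/\ N (y - x) < e, S s & N (d y - s) <= 2 * n%:R].
  move=> xr e0; have e2 : 0 < e / 2 by rewrite divr_gt0.
  have [|y [[s Ss ys] yx]] := dense (x0 + x) _ _ e2; first by rewrite addrAC subrr add0r.
  have [|z [[t St zt] zx]] := dense x0 _ _ e2; first by rewrite subrr (nm0 bN).
  exists (y - z), (s - t); split.
  - have -> : y - z - x = (y - (x0 + x)) - (z - x0) by ring.
    by have := nmB bN (y - (x0 + x)) (z - x0); lra.
  - by apply: sepD => //; apply: sepN.
  - have -> : d (y - z) - (s - t) = (d y - s) - (d z - t) by rewrite linearB; ring.
    by have := nmB bN (d y - s) (d z - t); lra.
pose K := 4 * n%:R / r.
have K0 : 0 <= K by rewrite /K !mulr_ge0// invr_ge0 ltW.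
(* Scaling by [t = r / (2 * h)] brings [x] into the ball. Scaled back, the error [r / 4] becomes
   [h / 2] and the bound [2 * n] becomes [K * h]. *)
have step (xh : A * R) : exists ys : A * A, 0 < xh.2 -> N xh.1 <= xh.2 ->
    [/\ N (xh.1 - ys.1) <= xh.2 / 2, S ys.2 & N (d ys.1 - ys.2) <= K * xh.2].
  case: xh => x h /=; have [h0|h0] := ltP 0 h; last by exists (0, 0).
  pose t := r / (2 * h).
  have h2 : 0 < 2 * h by lra.
  have t0 : 0 < t by rewrite divr_gt0.
  have [xh|//] := leP (N x) h; last by exists (0, 0).
  have th : t * h = r / 2 by rewrite /t; field; rewrite gt_eqF.
  have tV : t != 0 by rewrite gt_eqF.
  have tC : t%:C%C != 0 :> R[i] by rewrite (inj_eq (@complexI R)) .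
  have [||y [s [yx Ss ys]]] := near0 (t%:C%C *: x) (r / 4).
  - by rewrite (nmZr bN) gtr0_norm//; nra.
  - by rewrite divr_gt0.
  have back u v : N (u - t%:C%C *: v) = t * N (t^-1%:C%C *: u - v).
    rewrite -{2}(gtr0_norm t0) -(nmZr bN) scalerBr scalerA -rmorphM /=.
    by rewrite divff// scale1r.
  exists (t^-1%:C%C *: y, t^-1%:C%C *: s) => _ _ /=; split.
  - rewrite (nm_distC bN) -(ler_pM2l t0) -back mulrA th; lra.
  - exact: sepZr.
  - rewrite linearZ_LR /= -scalerBr (nmZr bN) gtr0_norm ?invr_gt0//.
    rewrite -(ler_pM2l t0) mulrA divff// mul1r mulrCA th /K.
    apply: (le_trans ys); rewrite le_eqVlt; apply/orP; left; apply/eqP.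
    by field; rewrite gt_eqF.
have {step near0}[f hf] := choice step.
exists (2 * K); first by rewrite mulr_ge0.
move=> x; have [x00|x0'] := eqVneq (N x) 0.
  by exists 0; [exact: sep0|rewrite (nm_eq0 bN x00) linear0 subrr (nm0 bN) mulr0].
have h0 : 0 < N x by rewrite lt_def x0' (nm_ge0 bN).
(* [us k] is (the k-th remainder of [x], the k-th partial sum of corrections). *)
pose us := fix us k : A * A := if k is k.+1 then
  ((us k).1 - (f ((us k).1, N x * 2 ^- k)).1,
   (us k).2 + (f ((us k).1, N x * 2 ^- k)).2) else (x, 0).
have hk k : 0 < N x * 2 ^- k by rewrite mulr_gt0// exp2V_gt0.
have uN k : N (us k).1 <= N x * 2 ^- k.
  elim: k => [|k IH]; first by rewrite expr0 invr1 mulr1.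
  case: (hf ((us k).1, N x * 2 ^- k) (hk k) IH) => h _ _.
  by apply: (le_trans h); rewrite /= (exp2VS R k); lra.
have Sk k : S (us k).2.
  elim: k => [|k IH]; first exact: sep0.
  by case: (hf ((us k).1, N x * 2 ^- k) (hk k) (uN k)) => _ Sf _; apply: sepD.
(* The images under [d] of the pieces removed so far, minus their corrections; the increments are at
   most [K * N x * 2 ^- k]. *)
pose w k := d x - d (us k).1 - (us k).2.
have [l hl] : exists l, forall k, N (l - w k) <= 2 * (K * N x) * 2 ^- k.
  apply: (geometric_limit bN) => k; rewrite -mulrA.
  have -> : w k.+1 - w k =
      d (f ((us k).1, N x * 2 ^- k)).1 - (f ((us k).1, N x * 2 ^- k)).2.
    by rewrite /w /= linearB /=; ring.
  by case: (hf ((us k).1, N x * 2 ^- k) (hk k) (uN k)).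
exists (d x - l); last first.
  rewrite subKr; have := hl 0%N; rewrite /w /= subrr !subr0 expr0 invr1; lra.
(* [d x - l] is separating: the remainder [(us k).1] is small, and [(us k).2] is nearly [d x'] with
   [x'] small. *)
move=> e e0; have e2 : 0 < e / 2 by lra.
have [k hkk] := exp2V_mul_lt (N x + 2 * (K * N x)) e2.
have [x' [x'1 x'2]] := Sk k _ e2.
have p1 := hl k; have p2 := uN k; have p3 := exp2V_gt0 R k.
exists ((us k).1 + x'); split.
  have := nmD bN (us k).1 x'.
  have := mulr_ge0 (mulr_ge0 K0 (nm_ge0 bN x)) (ltW p3).
  by lra.
have -> : d ((us k).1 + x') - (d x - l) = (l - w k) + (d x' - (us k).2).
  by rewrite /w linearD /=; ring.
have := nmD bN (l - w k) (d x' - (us k).2).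
have : 0 <= N x * 2 ^- k by rewrite ltW.
lra.
Qed.

End SeparatingSpace.

(** * Gliding hump in the separating space *)

Section Stability.
Variables (R : realType) (A : comAlgType R[i]) (N : A -> R).
Hypothesis bN : banach_norm N.
Variable d : {linear A -> A}.
Hypothesis dM : forall x y, d (x * y) = d x * y + x * d y.
Local Notation S := (separating_space N d).

(* [y n] is the sum over [k >= n] of [a n * ... * a k.-1 * x k]. *)
Lemma weighted_tails (a x : nat -> A) :
  (forall n, N (a n) <= 1) -> (forall n, N (x n) <= 2 ^- n) ->
  exists y : nat -> A, forall n, N (y n) <= 2 /\ y n = x n + a n * y n.+1.
Proof.
(* [T n m] keeps the first [m] terms of the tail starting at [n]. *)
move=> a1 x1; pose T := fix T n m := if m is m.+1 then x n + a n * T n.+1 m else 0.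
have TS m : forall n, N (T n m.+1 - T n m) <= 2 ^- n * 2 ^- m.
  elim: m => [|m IH] n.
    by rewrite /= mulr0 addr0 subr0 expr0 invr1 mulr1.
  have -> : T n m.+2 - T n m.+1 = a n * (T n.+1 m.+1 - T n.+1 m) by rewrite /=; ring.
  apply: (le_trans (nmM_le bN (a1 n) (IH n.+1))).
  by rewrite mul1r !exprS !invfM le_eqVlt; apply/orP; left; apply/eqP; ring.
have lim n : exists v, forall m, N (v - T n m) <= 2 * 2 ^- n * 2 ^- m.
  by apply: (geometric_limit bN) => m; exact: TS.
have {lim}[y hy] := choice lim.
have exp2V_le1 n : 2 ^- n <= 1 :> R by rewrite invf_le1 ?exprn_gt0// exprn_ege1// ler1n.
exists y => n; split.
  have := hy n 0%N; rewrite subr0 expr0 invr1 mulr1.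
  by have := exp2V_le1 n; lra.
apply/eqP; rewrite -subr_eq0; apply/eqP/(nm_le0 bN)/(@le0_exp2V _ _ 4) => m.
have -> : y n - (x n + a n * y n.+1) = (y n - T n m.+1) - a n * (y n.+1 - T n.+1 m).
  by rewrite /=; ring.
have := nmB bN (y n - T n m.+1) (a n * (y n.+1 - T n.+1 m)).
have := nmM_le bN (a1 n) (hy n.+1 m); have := hy n m.+1.
have := exp2V_le1 n; have := exp2V_le1 n.+1; have := exp2V_gt0 R m.+1.
have := exp2VS R m.
move: (2 ^- m) (2 ^- m.+1) (2 ^- n) (2 ^- n.+1) => h h' g g' -> h0 g1 g2.
have := ler_wpM2r (ltW h0) g1; have := ler_wpM2r (ltW h0) g2; lra.
Qed.

(* Gliding hump: [d] would be unbounded at [\sum_n b n * x n]. *)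
Lemma separating_stability (a : nat -> A) (b := fun n => \prod_(i < n) a i) :
  (forall n, N (a n) <= 1) ->
  ~ forall n, exists2 s, S s & exists2 t, 0 < t &
      forall s', S s' -> t <= N (b n * s - b n.+1 * s').
Proof.
move=> a1 drop.
have [C C0 hC] := bounded_mod_sep bN dM.
(* A small [x] whose image [d (b n * x)] is as far as desired from [b n.+1 S]: take [x] near 0 with
   [d x] near [s], then enlarge by [k]. *)
have bump (ne : nat * R) : exists x, 0 < ne.2 -> N x <= 2 ^- ne.1 /\
    forall s', S s' -> ne.2 <= N (d (b ne.1 * x) - b ne.1.+1 * s').
  case: ne => n M /=; have [M0|M0] := ltP 0 M; last by exists 0.
  have [s Ss [t t0 hs]] := drop n.
  pose k := 2 * M / t; have k0 : 0 < k by rewrite divr_gt0// mulr_gt0.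
  pose L := N (d (b n)) + N (b n) + 1.
  have [db0 b0] := (nm_ge0 bN (d (b n)), nm_ge0 bN (b n)).
  have L0 : 0 < L by rewrite /L; lra.
  (* The first bound keeps the error below [t / 2]; the second keeps the enlarged element below
     [2 ^- n]. *)
  pose h := Num.min (t / (2 * L)) (2 ^- n / k).
  have h0 : 0 < h by rewrite lt_min !divr_gt0 ?mulr_gt0// exp2V_gt0.
  have hL : h * L <= t / 2.
    have : h <= t / (2 * L) by rewrite ge_min lexx.
    by rewrite invfM mulrA ler_pdivlMr.
  have hk : k * h <= 2 ^- n.
    by rewrite mulrC -ler_pdivlMr// ge_min lexx orbT.
  have [x [x1 x2]] := Ss _ h0.
  exists (k%:C%C *: x) => _; split.
    by rewrite (nmZr bN) gtr0_norm//; apply: le_trans hk; rewrite ler_pM2l// ltW.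
  move=> s' Ss'; have kC : k%:C%C != 0 :> R[i] by rewrite (inj_eq (@complexI R)) gt_eqF.
  have -> : d (b n * (k%:C%C *: x)) - b n.+1 * s' =
      k%:C%C *: (d (b n * x) - b n.+1 * (k^-1%:C%C *: s')).
    by rewrite -!scalerAr linearZ_LR scalerBr scalerA -rmorphM divff ?gt_eqF// scale1r.
  rewrite (nmZr bN) gtr0_norm//.
  have := hs _ (sepZr bN dM k^-1 Ss'); set s2 := (k^-1%:C%C *: s') => ts.
  have : t / 2 <= N (d (b n * x) - b n.+1 * s2).
    have := nmB bN (d (b n * x) - b n.+1 * s2) (d (b n) * x + b n * (d x - s)).
    have -> : d (b n * x) - b n.+1 * s2 - (d (b n) * x + b n * (d x - s)) =
      b n * s - b n.+1 * s2 by rewrite dM; ring.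
    have := nmD bN (d (b n) * x) (b n * (d x - s)).
    have := nmM_le bN (lexx (N (d (b n)))) (ltW x1).
    have := nmM_le bN (lexx (N (b n))) (ltW x2).
    by move: hL; rewrite /L; lra.
  rewrite -(ler_pM2l k0); apply: le_trans.
  by rewrite /k le_eqVlt; apply/orP; left; apply/eqP; field; rewrite gt_eqF.
have {bump}[X hX] := choice bump.
(* Since [N (y n.+1) <= 2], the tail [d (b n.+1 * y n.+1)] lies within [2 * c n] of [b n.+1 S]. *)
pose c n := N (d (b n.+1)) + N (b n.+1) * C.
have c0 n : 0 <= c n by rewrite addr_ge0 ?mulr_ge0 ?(nm_ge0 bN).
(* The new hump must outweigh the tail and the earlier terms [z] by [n.+1]. *)
pose M n z := n.+1%:R + 2 * c n + N (d z).
have M0 n z : 0 < M n z.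
  by rewrite /M; have := nm_ge0 bN (d z); have := c0 n; have := ltr0Sn R n; lra.
pose z := fix z n := if n is n.+1 then z n + b n * X (n, M n (z n)) else 0.
pose x n := X (n, M n (z n)).
have [y hy] := weighted_tails a1 (fun n => proj1 (hX (n, M n (z n)) (M0 n (z n)))).
have bS n : b n.+1 = b n * a n by rewrite /b big_ord_recr.
have yE n : y 0%N = z n + b n * y n.
  elim: n => [|n ->] /=; first by rewrite /b big_ord0 mul1r add0r.
  by rewrite bS [y n](proj2 (hy n)) mulrDr mulrA addrA.
have big n : n.+1%:R <= N (d (y 0%N)).
  have [s Ss ds] := hC (y n.+1).
  have [yn _] := hy n.+1.
  have near : N (d (b n.+1 * y n.+1) - b n.+1 * s) <= 2 * c n.
    have -> : d (b n.+1 * y n.+1) - b n.+1 * s =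
        d (b n.+1) * y n.+1 + b n.+1 * (d (y n.+1) - s).
      by rewrite dM; ring.
    apply: (le_trans (nmD bN _ _)).
    have := nmM_le bN (lexx (N (d (b n.+1)))) yn.
    have ds2 : N (d (y n.+1) - s) <= C * 2 by apply: le_trans ds _; rewrite ler_wpM2l.
    by have := nmM_le bN (lexx (N (b n.+1))) ds2; rewrite /c; lra.
  have := proj2 (hX (n, M n (z n)) (M0 n (z n))) (- s) (sepN bN dM Ss); rewrite /= {1}/M.
  have -> : d (b n * X (n, M n (z n))) - b n.+1 * - s =
      d (y 0%N) - d (z n) - (d (b n.+1 * y n.+1) - b n.+1 * s).
    have cancel (p q r v : A) : q + v = p + q + r - p - (r - v) by ring.
    by rewrite mulrN opprK (yE n.+1) /= !(raddfD d); apply: cancel.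
  have := nmB bN (d (y 0%N) - d (z n)) (d (b n.+1 * y n.+1) - b n.+1 * s).
  by have := nmB bN (d (y 0%N)) (d (z n)); lra.
have := big (Num.truncn (N (d (y 0%N)))).
by rewrite leNgt truncnS_gt.
Qed.

End Stability.

(** * Minimal multiples and idempotents *)

Section MinimalIdempotent.
Variables (R : realType) (A : comAlgType R[i]) (N : A -> R).
Hypothesis bN : banach_norm N.
Variable d : {linear A -> A}.
Hypothesis dM : forall x y, d (x * y) = d x * y + x * d y.
Hypothesis semisimple : forall a : A, (forall b, exists v, (1 - b * a) * v = 1) -> a = 0.
Local Notation S := (separating_space N d).

(** Otherwise every nonzero [a S] could be shrunk strictly, even up to closure, by a further factor,
    and the successive products would contradict [separating_stability]. *)
Lemma minimal_multiple : (exists2 s, S s & s != 0) ->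
  exists2 a, exists2 s, S s & a * s != 0 &
    forall b, (forall s, S s -> b * (a * s) = 0) \/
      forall s t, S s -> 0 < t -> exists2 s', S s' & N (a * s - b * (a * s')) < t.
Proof.
move=> [s0 Ss0 s00]; apply: contrapT => nmin.
have step (a : A) : exists b, (exists2 s, S s & a * s != 0) ->
    [/\ N b <= 1, exists2 s, S s & a * b * s != 0 &
      exists2 s, S s & exists2 t, 0 < t &
        forall s', S s' -> t <= N (a * s - a * b * s')].
  case: (pselect (exists2 s, S s & a * s != 0)) => [as0|]; last by exists 0.
  apply: contrapT => nb; apply: nmin; exists a => // b.
  apply: contrapT => /not_orP[/existsNP[s /not_implyP[Ss bas]]].
  move=> /existsNP[u /existsNP[t /not_implyP[Su /not_implyP[t0 far]]]].
  (* Normalizes the factor to norm at most 1; [S] absorbs the scalar. *)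
  pose k := (1 + N b)^-1.
  have k0 : 0 < k by rewrite invr_gt0; have := nm_ge0 bN b; lra.
  have kC : k%:C%C != 0 :> R[i] by rewrite (inj_eq (@complexI R)) gt_eqF.
  apply: nb; exists (k%:C%C *: b) => _; split.
  - rewrite (nmZr bN) gtr0_norm// /k ler_pdivrMl; have := nm_ge0 bN b; lra.
  - exists s => //; rewrite -scalerAr -scalerAl scaler_eq0 (negbTE kC) /=.
    by apply/eqP => h; apply: bas; rewrite mulrA (mulrC b).
  - exists u => //; exists t => // s' Ss'; rewrite leNgt; apply/negP => close.
    apply: far; exists (k%:C%C *: s'); first exact: sepZr.
    have -> : b * (a * (k%:C%C *: s')) = a * (k%:C%C *: b) * s'; last by [].
    by rewrite -!scalerAr -scalerAl; congr (_ *: _); ring.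
have {step}[f hf] := choice step.
pose b := fix b n := if n is n.+1 then b n * f (b n) else 1.
have nz n : exists2 s, S s & b n * s != 0.
  elim: n => [|n IH] /=; first by exists s0; rewrite ?mul1r.
  by case: (hf _ IH).
have bE n : b n = \prod_(i < n) f (b i).
  by elim: n => [|n IH]; rewrite ?big_ord0// big_ord_recr -IH.
apply: (separating_stability bN dM (a := fun n => f (b n))).
  by move=> n; case: (hf _ (nz n)).
by move=> n; rewrite -!bE; case: (hf _ (nz n)).
Qed.

Lemma separating_idempotent : (exists2 s, S s & s != 0) ->
  exists e, [/\ S e, e != 0, e * e = e &
    forall b, b * e != 0 -> exists y, b * e * y = e].
Proof.
move=> /minimal_multiple[a [s Ss as0] amin].
have [c hc] : exists c, forall v, (1 - c * (a * s)) * v <> 1.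
  apply: contrapT => H; move/eqP: as0; apply; apply: semisimple => c.
  by apply: contrapT => nv; apply: H; exists c => v hv; apply: nv; exists v.
have {}hc v : (1 - a * (c * s)) * v <> 1.
  by rewrite (_ : a * (c * s) = c * (a * s)); [exact: hc|ring].
have Scs : S (c * s) by apply: sepM.
set t := a * (c * s) in hc.
(* If [(1 - t) a S] were dense in [a S], some [(1 - t) * (a * s')] would approximate [t] within 1,
   and the Neumann series would make [(1 - t) * (1 + a * s')], hence [1 - t], invertible. So [1 - t]
   kills [a S]. *)
have t_id x : S x -> t * (a * x) = a * x.
  move=> Sx; case: (amin (1 - t)) => [h|h].
    by apply/esym/eqP; rewrite -subr_eq0 -{1}[a * x]mul1r -mulrBl h.
  have [s' Ss' close] := h _ 1 Scs ltr01.
  have [v hv] := neumann bN close.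
  by case: (hc ((1 + a * s') * v)); rewrite -{}[RHS]hv /t; ring.
have tt : t * t = t by apply: t_id.
have t0 : t != 0.
  by apply/eqP => t0; apply: (hc 1); rewrite t0 subr0 mulr1.
exists t; split => // [|b bt0]; first by apply: sepM.
(* As [t] lies in [a S], [b] does not kill [a S]. Density gives [y] with [N (t - b * y) < 1]; the
   inverse [v] of [1 - (t - b * y)], multiplied by [t], yields [b * y * v = t]. *)
case: (amin b) => [h|h]; first by rewrite h ?eqxx in bt0.
have [s' Ss' close] := h _ 1 Scs ltr01.
have [v hv] := neumann bN close.
have ty := t_id _ Ss'; move: (a * s') ty hv {close} => y; rewrite -/t => ty hv.
exists (y * v).
have -> : b * t * (y * v) = t * ((1 - (t - b * y)) * v) + (b * (t * y) - b * y) * v +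
   (t * t - t) * v - t * (b * y) * v + b * y * v by ring.
have -> : t * (b * y) = b * y by rewrite -[in RHS]ty; ring.
by rewrite ty tt !subrr !mul0r hv mulr1 !addr0 -addrA addNr addr0.
Qed.

End MinimalIdempotent.

(** * Derivations of semisimple algebras *)

Section SemisimpleDerivations.
Variables (R : realType) (A : comAlgType R[i]) (N : A -> R).
Hypothesis bN : banach_norm N.
Variable d : {linear A -> A}.
Hypothesis dM : forall x y, d (x * y) = d x * y + x * d y.
Hypothesis semisimple : forall a : A, (forall b, exists v, (1 - b * a) * v = 1) -> a = 0.
Local Notation S := (separating_space N d).

Lemma derivation_idempotent e : e * e = e -> d e = 0.
Proof.
move=> ee; have h : d e = d e * e + e * d e by rewrite -dM ee.
have ede : e * d e = 0.
  have : e * d e = e * e * d e + e * e * d e by rewrite {1}h; ring.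
  by rewrite ee -[LHS]addr0 => /addrI.
by rewrite h ede mulrC ede addr0.
Qed.

Lemma separating_space_trivial s : S s -> s = 0.
Proof.
move=> Ss; apply/eqP; apply: contrapT => /negP s0.
have [|e [Se e0 ee einv]] := separating_idempotent bN dM semisimple; first by exists s.
have [x [_ xe]] := Se 2^-1 ltac:(by rewrite invr_gt0).
have [l xl] := gelfand_mazur bN e0 ee einv x.
have de0 := derivation_idempotent ee.
have edx : e * d x = 0.
  have : d (e * x) = 0 by rewrite xl linearZ_LR de0 scaler0.
  by rewrite dM de0 mul0r add0r.
move/eqP: e0; apply; apply: (nm_le0 bN).
(* Here [N (e - d x) < 2^-1], so this forces [N e <= N e / 2]. *)
have eE : e * (e - d x) = e by rewrite mulrBr ee edx subr0.
rewrite (nm_distC bN) in xe.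
have := nmM_le bN (lexx (N e)) (ltW xe); rewrite eE.
have := nm_ge0 bN e; lra.
Qed.

Lemma derivation_bounded : exists2 C, 0 <= C & forall x, N (d x) <= C * N x.
Proof.
have [C C0 hC] := bounded_mod_sep bN dM; exists C => // x.
by have [s /separating_space_trivial ->] := hC x; rewrite subr0.
Qed.

(** * The Kleinecke-Shirokov identity *)

Section KleineckeShirokov.
Variable a : A.

(** The commutator of [T] with multiplication by [a]. *)
Definition ad_mul (T : A -> A) (x : A) : A := T (a * x) - a * T x.

(** The commutator of [d] with multiplication by [a] is multiplication by [d a], which commutes with
    [a]; only the first two Leibniz terms survive. For [k = 0] the truncated index is harmless, its
    term being multiplied by 0. *)
Lemma ad_mul_deriv k (T : A -> A) x : iter k ad_mul (fun z => d (T z)) x =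
  d (iter k ad_mul T x) + (d a * iter k.-1 ad_mul T x) *+ k.
Proof.
elim: k x => [|k IH] x; first by rewrite /= mulr0n addr0.
have key : iter k.-1 ad_mul T (a * x) *+ k - a * (iter k.-1 ad_mul T x *+ k) =
    iter k ad_mul T x *+ k.
  by case: k {IH} => [|k]; rewrite ?mulr0n ?mulr0 ?subr0// mulrnAr -mulrnBl.
rewrite iterS {1}/ad_mul !IH [iter k.+1 _ T]iterS {1}/ad_mul linearB dM.
rewrite [k.+1.-1]/= mulrS -!mulrnAr -{}key.
move: (iter k ad_mul T x) (d _) (d _) => p q u.
by move: (_ *+ k) (_ *+ k) (d a) => v w c; ring.
Qed.

(** The second half, which says that one more commutator gives 0, removes the leading term in the
    induction. *)
Lemma ad_mul_iter n : (forall x, iter n ad_mul (iter n d) x = (d a ^+ n * x) *+ n`!) /\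
  (forall x, iter n.+1 ad_mul (iter n d) x = 0).
Proof.
elim: n => [|n [IH1 IH2]].
  by split=> x; rewrite /= ?expr0 ?mul1r ?mulr1n// /ad_mul subrr.
have ext k x : iter k ad_mul (iter n.+1 d) x =
  iter k ad_mul (fun z => d (iter n d z)) x by [].
split=> x; rewrite ext ad_mul_deriv.
  rewrite IH2 linear0 add0r /= IH1 mulrnAr -mulrnA mulrA -exprS factS.
  by rewrite mulnC.
by rewrite iterS /= -iterS {1}/ad_mul !IH2 mulr0 subrr linear0 add0r mulr0 mul0rn.
Qed.

Lemma iter_bound C n x : 0 <= C -> (forall x, N (d x) <= C * N x) ->
  N (iter n d x) <= C ^+ n * N x.
Proof.
move=> C0 hC; elim: n => [|n IH]; first by rewrite expr0 mul1r.
by rewrite iterS exprS -mulrA (le_trans (hC _))// ler_wpM2l.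
Qed.

Lemma ad_mul_bound k (T : A -> A) B x : (forall x, N (T x) <= B * N x) ->
  N (iter k ad_mul T x) <= (2 * N a) ^+ k * (B * N x).
Proof.
move=> hT; elim: k x => [|k IH] x; first by rewrite expr0 mul1r.
rewrite iterS {1}/ad_mul; apply: (le_trans (nmB bN _ _)).
have a0 := nm_ge0 bN a.
(* The sign of [B] is not given, but [0 <= N (T x) <= B * N x] excludes a negative [B] unless
   [N x = 0]. *)
have B0 : 0 <= B \/ N x = 0.
  have [|x0] := eqVneq (N x) 0; [by right|left].
  have := le_trans (nm_ge0 bN (T x)) (hT x).
  by rewrite pmulr_lge0// lt_def x0 (nm_ge0 bN).
have h1 := nmM_le bN (lexx (N a)) (IH x).
have h2 := IH (a * x).
have h3 : (2 * N a) ^+ k * (B * N (a * x)) <= (2 * N a) ^+ k * (B * (N a * N x)).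
  rewrite ler_wpM2l ?exprn_ge0 ?mulr_ge0//.
  case: B0 => [B0|x0]; first by rewrite ler_wpM2l// (nmM bN).
  have : N (a * x) <= 0 by rewrite (le_trans (nmM bN _ _))// x0 mulr0.
  by move=> /(nm_le0 bN) ->; rewrite (nm0 bN) x0 !mulr0.
by rewrite exprS; lra.
Qed.

End KleineckeShirokov.

Lemma nm_natmul x n : N (x *+ n) = n%:R * N x.
Proof.
by rewrite -scaler_nat -(rmorph_nat (real_complex R)) (nmZr bN) normr_nat.
Qed.

(** Boundedness of [d] and the commutator identity bound [N ((b * d a) ^+ k)] by
    [M ^+ k * N 1 / k!], which is below 1 for some [k]. *)
Lemma derivation_quasinilpotent a b : exists v, (1 - b * d a) * v = 1.
Proof.
have [C C0 hC] := derivation_bounded.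
pose M := N b * (2 * N a * C).
have M0 : 0 <= M by rewrite !mulr_ge0 ?(nm_ge0 bN).
have N10 : 0 < N 1 + 1 by rewrite ltr_wpDl ?(nm_ge0 bN).
have e0 : 0 < (N 1 + 1)^-1 by rewrite invr_gt0.
have /cvgrPdist_lt/(_ _ e0)[n _ /(_ n.+1 (leqnSn n))] := @cvg_exp_coeff R M.
rewrite sub0r normrN /exp_coeff ger0_norm; last by rewrite divr_ge0 ?exprn_ge0.
set k := n.+1 => small.
apply: (@neumann_pow _ _ _ bN _ n); rewrite exprMn -/k.
have f0 : 0 < k`!%:R :> R by rewrite ltr0n fact_gt0.
have hk : k`!%:R * N (d a ^+ k) <= (2 * N a * C) ^+ k * N 1.
  rewrite -nm_natmul -[d a ^+ k]mulr1 -(proj1 (ad_mul_iter a k)).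
  apply: (le_trans (ad_mul_bound _ _ _ (fun x => iter_bound k x C0 hC))).
  by rewrite mulrA -exprMn.
rewrite -(ltr_pM2l f0).
have hb := nmM_le bN (nmX bN b n) (lexx (N (d a ^+ k))).
apply: (le_lt_trans (ler_wpM2l (ltW f0) hb)).
have h1 : N b ^+ k * (k`!%:R * N (d a ^+ k)) <= M ^+ k * N 1.
  by rewrite /M exprMn -[leRHS]mulrA ler_wpM2l ?exprn_ge0 ?(nm_ge0 bN).
rewrite mulrCA (le_lt_trans h1)// mulr1.
move: small; rewrite ltr_pdivrMr// mulrC ltr_pdivlMr// => h2.
have := exprn_ge0 k M0; lra.
Qed.

Lemma semisimple_derivation_eq0 x : d x = 0.
Proof. by apply: semisimple => b; exact: derivation_quasinilpotent. Qed.

End SemisimpleDerivations.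

(** * The equivalence *)

Lemma rnorm_complete (R : realType) (V : completeNormedModType R[i]) (u : nat -> V) :
  (forall e : R, 0 < e -> exists n0, forall m n,
     (n0 <= m)%N -> (n0 <= n)%N -> rnorm (u m - u n) < e) ->
  exists l, forall e : R, 0 < e -> exists n0, forall n,
    (n0 <= n)%N -> rnorm (l - u n) < e.
Proof.
move=> hu.
have posE (e : R[i]) : 0 < e -> e = (complex.Re e)%:C%C /\ 0 < complex.Re e.
  by case: e => a b; rewrite ltcE /= => /andP[/eqP -> a0].
have cu : cvg (u @ \oo).
  apply: cauchy_cvg; apply: cauchy_exP => e /posE[-> e0].
  have [n0 h] := hu _ e0.
  exists (u n0), n0 => // n /= n0n.
  by rewrite -ball_normE /= -rnormE ltcR; exact: h.
exists (lim (u @ \oo)) => e e0.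
have e0' : 0 < e%:C%C :> R[i] by rewrite ltcR.
have /cvgrPdist_lt/(_ _ e0')[n0 _ h] := cu.
by exists n0 => n n0n; rewrite -ltcR rnormE; exact: h.
Qed.

(** The quasi-product of [c] and [w] is [1 - (1 - c) * (1 - w)]. *)
Lemma quasi_inverse (A : comNzRingType) (c v : A) :
  (1 - c) * v = 1 -> c + (1 - v) - c * (1 - v) = 0.
Proof.
by move=> cv; transitivity (1 - (1 - c) * v); [ring|rewrite cv subrr].
Qed.

(** * Derivations of the given Banach algebra *)

Section BanachAlgebraDerivations.
Variables (R : realType) (V : completeNormedModType R[i]) (mul : V -> V -> V).
Hypothesis banach : is_banach_algebra mul.

Lemma unital_semisimple_derivation_eq0 (e : V) (d : V -> V) :
  (forall a, mul a e = a) -> (forall a b, mul a b = mul b a) ->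
  (forall a, jrad mul a -> a = 0) -> is_derivation mul d -> forall x, d x = 0.
Proof.
move: banach => [linl linr mulA normM] mule mulC rad0 [dlin dmul] x.
(* The ring structure requires a nonzero unit, so the zero algebra is treated apart. *)
have [e0|e0] := eqVneq e 0.
  have mul0 a : mul a 0 = 0.
    by have := linr (-1) e e a; rewrite scaleN1r addNr !mule scaleN1r addNr.
  by rewrite -(mule (d x)) e0 mul0.
have mulDl a b c : mul (a + b) c = mul a c + mul b c.
  by have := linl 1 a b c; rewrite !scale1r.
have mul1 a : mul e a = a by rewrite mulC mule.
have mulA' a b c : mul a (mul b c) = mul (mul a b) c by rewrite mulA.
pose W : comNzRingType := HB.pack (V : Type) (GRing.Lmodule.class V)
  (GRing.Zmodule_isComNzRing.Build V mulA' mulC mul1 mulDl e0).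
have mulZl (k : R[i]) (a b : V) : k *: mul a b = mul (k *: a) b.
  have := linl k a 0 b; rewrite !addr0 => ->.
  by have := linl (-1) a a b; rewrite scaleN1r addNr scaleN1r addNr => ->; rewrite addr0.
pose W1 : lalgType R[i] := HB.pack (V : Type) W (GRing.Lmodule.class V)
  (GRing.Lmodule_isLalgebra.Build R[i] W mulZl).
have mulZr (k : R[i]) (a b : W1) : k *: (a * b) = a * (k *: b).
  by rewrite -[a * b]/(mul a b) mulC mulZl mulC.
pose W2 : comAlgType R[i] := HB.pack (V : Type) W W1
  (GRing.Lalgebra_isAlgebra.Build R[i] W1 mulZr).
have bN : @banach_norm R W2 (fun v : V => rnorm v).
  split.
  - exact: rnorm_eq0.
  - exact: rnorm_triangle.
  - by move=> k v; apply: complexI; rewrite rmorphM /= !rnormE normrZ.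
  - by move=> v w; rewrite -lecR rmorphM /= !rnormE normM.
  - exact: rnorm_complete.
pose D : {linear W2 -> W2} := HB.pack (d : W2 -> W2)
  (GRing.isLinear.Build R[i] W2 W2 _ (d : W2 -> W2) dlin).
apply: (@semisimple_derivation_eq0 R W2 _ bN D dmul).
move=> a ha; apply: rad0 => b; have [v hv] := ha b.
have inv := quasi_inverse hv.
exists (e - v); split; first exact: inv.
by rewrite [e - v + _]addrC [mul (e - v) _]mulC; exact: inv.
Qed.

Lemma inner_der_derivation (a : V) : is_derivation mul (inner_der mul a).
Proof.
move: banach => [linl linr mulA _]; split=> [k x y|x y]; rewrite /inner_der.
  by rewrite linl linr opprD addrACA scalerBr.
have mulBl u v w : mul (u - v) w = mul u w - mul v w.
  by rewrite -scaleN1r addrC linl scaleN1r addrC.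
have mulBr u v w : mul w (u - v) = mul w u - mul w v.
  by rewrite -scaleN1r addrC linr scaleN1r addrC.
by rewrite mulBl mulBr !mulA [RHS]addrC addrA subrK.
Qed.

End BanachAlgebraDerivations.

Theorem theorem4p3 (R : realType) (V : completeNormedModType R[i]) (mul : V -> V -> V) :
  is_banach_algebra mul ->
  jrad mul = rann mul ->
  quot_rad_commutative mul ->
  has_right_identity mul ->
  (has_identity mul <-> (forall d : V -> V, is_derivation mul d -> forall x, d x = 0)) /\
  ((forall d : V -> V, is_derivation mul d -> forall x, d x = 0) <->
     (forall a x : V, inner_der mul a x = 0)) /\
  ((forall a x : V, inner_der mul a x = 0) <-> is_commutative mul).
Proof.
move=> banach rad_rann comm_mod [e0 mule0].
have unital_der0 : has_identity mul ->
    forall d : V -> V, is_derivation mul d -> forall x, d x = 0.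
  (* An element of the radical is a right annihilator, so [e] sends it both to itself and to 0. *)
  move=> [e e1]; have rad0 a : jrad mul a -> a = 0.
    by rewrite rad_rann => /(_ e); rewrite (proj2 (e1 a)).
  have mulC a b : mul a b = mul b a.
    by apply/eqP; rewrite -subr_eq0; apply/eqP/rad0; have := comm_mod a b; rewrite inE.
  move=> d; apply: (unital_semisimple_derivation_eq0 banach _ mulC rad0).
  by move=> a; case: (e1 a).
have der0_inner0 : (forall d : V -> V, is_derivation mul d -> forall x, d x = 0) ->
    forall a x : V, inner_der mul a x = 0.
  by move=> der0 a; apply: der0; exact: inner_der_derivation.
have inner0_comm : (forall a x : V, inner_der mul a x = 0) <-> is_commutative mul.
  split=> [inner0 a b|mulC a b]; last by rewrite /inner_der mulC subrr.
  by apply/eqP; rewrite -subr_eq0; apply/eqP; exact: inner0.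
(* Commutativity makes the right identity [e0] two-sided. *)
have inner0_unital : (forall a x : V, inner_der mul a x = 0) -> has_identity mul.
  by move=> /inner0_comm mulC; exists e0 => a; rewrite (mulC e0) mule0.
split; first by split=> // /der0_inner0.
by split=> //; split=> // /inner0_unital.
Qed.
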